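(* Let $B\subset U\subset\mathbb{R}^N$ and let $f,P\in\mathbb{R}[x_1,\dots,x_N]$. Define $$\delta:=\min_{x\in B}|\operatorname{grad} f(x)|_{\mathbb{R}^N}\quad\text{and}\quad \xi:=\min_{x\in U\setminus B}|f(x)|,$$ and assume $\xi>0$. If $\|P\|_{C^0(U\setminus B)}\le\xi$ and $\|\operatorname{grad}P\|_{C^0(B)}\le\delta$, then $M_\epsilon:=Z(f+\epsilon P)\cap U$ is smooth for all $\epsilon\in[0,1)$.
   Context: $Z(h)=\{x\in\mathbb{R}^N:h(x)=0\}$. $|\cdot|_{\mathbb{R}^N}$ is the Euclidean norm; $\|P\|_{C^0(S)}=\sup_{x\in S}|P(x)|$ and $\|\operatorname{grad}P\|_{C^0(S)}=\sup_{x\in S}|\operatorname{grad}P(x)|_{\mathbb{R}^N}$. $M_\epsilon$ is smooth means that $\operatorname{grad}(f+\epsilon P)(x)\neq0$ for every $x\in M_\epsilon$.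
   Formalization: The assumption δ > 0 is added to ξ > 0; without it the claim fails, e.g. N = 1, B = {0}, U = {0,1}, f = x², P = 0, ε = 0, where δ = 0, ξ = 1 and 0 is a singular point of M_0. Minima are read as infima. *)

(* Defs.v *)
From HB Require Import structures.
From mathcomp Require Import all_boot all_order all_algebra.
From mathcomp Require Import all_classical all_reals all_analysis.
(* The notations of mpoly clash with those of all_analysis, hence [mpoly N R]
   for the ring of polynomials in N variables over R. *)
From mathcomp Require Import -(notations) mpoly.

Set Implicit Arguments.
Unset Strict Implicit.
Unset Printing Implicit Defensive.

Import Order.TTheory GRing.Theory Num.Theory.
Import numFieldNormedType.Exports.
Local Open Scope classical_set_scope.
Local Open Scope ring_scope.

Definition peval (R : realType) (N : nat) (h : mpoly N R) (x : 'rV[R]_N) : R :=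
  meval (fun i => x ord0 i) h.

Definition grad (R : realType) (N : nat) (h : mpoly N R) (x : 'rV[R]_N) :
  'rV[R]_N := \row_(i < N) peval (mderiv i h) x.

(* The library norm on 'rV[R]_N is the sup norm. *)
Definition enorm (R : realType) (N : nat) (v : 'rV[R]_N) : R :=
  Num.sqrt (\sum_(i < N) v ord0 i ^+ 2).

(* Over arbitrary sets, extrema are taken in \bar R, with inf = +oo and
   sup = -oo on the empty set; [inf_on S g] is the minimum of g on S whenever
   that minimum is attained. *)
Definition inf_on (R : realType) (N : nat) (S : set 'rV[R]_N)
    (g : 'rV[R]_N -> R) : \bar R := ereal_inf [set (g x)%:E | x in S].

Definition sup_on (R : realType) (N : nat) (S : set 'rV[R]_N)
    (g : 'rV[R]_N -> R) : \bar R := ereal_sup [set (g x)%:E | x in S].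

Definition C0norm (R : realType) (N : nat) (S : set 'rV[R]_N) (h : mpoly N R) :
  \bar R := sup_on S (fun x => `|peval h x|).

Definition C0norm_grad (R : realType) (N : nat) (S : set 'rV[R]_N)
    (h : mpoly N R) : \bar R := sup_on S (fun x => enorm (grad h x)).

Definition zero_locus (R : realType) (N : nat) (h : mpoly N R) :
  set 'rV[R]_N := [set x | peval h x = 0].

Definition Meps (R : realType) (N : nat) (U : set 'rV[R]_N) (f P : mpoly N R)
    (eps : R) : set 'rV[R]_N := zero_locus (f + eps *: P) `&` U.

Definition Meps_smooth (R : realType) (N : nat) (U : set 'rV[R]_N)
    (f P : mpoly N R) (eps : R) : Prop :=
  forall x, Meps U f P eps x -> grad (f + eps *: P) x <> 0.

Lemma inf_on_min (R : realType) (N : nat) (S : set 'rV[R]_N)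
    (g : 'rV[R]_N -> R) (x0 : 'rV[R]_N) :
  S x0 -> (forall x, S x -> g x0 <= g x) -> inf_on S g = (g x0)%:E.
Proof.
move=> Sx0 gx0; apply/eqP; rewrite eq_le; apply/andP; split.
  by apply: ereal_inf_lbound; exists x0.
by apply: le_ereal_inf_tmp => _ [x Sx <-]; rewrite lee_fin gx0.
Qed.

(* The formal partial derivatives are the analytic ones. *)
Lemma grad_is_derive (R : realType) (N : nat) (h : mpoly N R) (x : 'rV[R]_N)
    (i : 'I_N) :
  is_derive x (delta_mx ord0 i : 'rV[R]_N) (peval h) (grad h x ord0 i).
Proof.
rewrite mxE; move: h.
pose Q (h : mpoly N R) := is_derive x (delta_mx ord0 i : 'rV[R]_N) (peval h)
  (peval (mderiv i h) x).
have QC c : Q (mpolyC N c).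
  rewrite /Q /peval mderivC meval0.
  have -> : (fun y : 'rV[R]_N => meval (fun i => y ord0 i) (mpolyC N c))
    = cst c by apply/funext => y; rewrite mevalC.
  exact: is_derive_cst.
have QM p q : Q p -> Q q -> Q (p * q).
  move=> Qp Qq; rewrite /Q.
  have -> : peval (p * q) = peval p * peval q.
    by apply/funext => y; rewrite /peval mevalM.
  apply: is_derive_eq (is_deriveM Qp Qq) _.
  by rewrite /peval mderivM mevalD !mevalM addrC mulrC.
have QD p q : Q p -> Q q -> Q (p + q).
  move=> Qp Qq; rewrite /Q.
  have -> : peval (p + q) = peval p + peval q.
    by apply/funext => y; rewrite /peval mevalD.
  by apply: is_derive_eq (is_deriveD Qp Qq) _; rewrite /peval mderivD mevalD.
have QX j : Q (mpolyX R (mnm1 j)).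
  rewrite /Q /peval.
  have -> : (fun y : 'rV[R]_N => meval (fun i => y ord0 i) (mpolyX R (mnm1 j)))
    = (fun y : 'rV[R]_N => y ord0 j) by apply/funext => y; rewrite mevalXU.
  pose c (y : 'rV[R]_N) : R^o := y ord0 j.
  have c_lin : linear c by move=> a u v; rewrite /c !mxE.
  pose cL : {linear 'rV[R]_N -> R^o} :=
    HB.pack c (GRing.isLinear.Build _ _ _ _ c c_lin).
  have c_cont : continuous cL by exact: coord_continuous.
  apply: DeriveDef.
    exact/diff_derivable/(@linear_differentiable _ _ _ cL).
  rewrite (@deriveE _ _ _ cL); last exact: linear_differentiable.
  rewrite diff_lin // mderivX mevalZ mevalX mnm1E.
  rewrite [LHS]/= /c mxE eqxx /=.
  have [->|_] := eqVneq j i; last by rewrite mul0r.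
  by rewrite mul1r big1 // => k _; rewrite mnmBE subnn expr0.
elim/mpolyind => [|c m p _ _ Qp]; first by rewrite -[0](mpolyC0 N R); exact: QC.
apply: (QD) => //; rewrite -mul_mpolyC; apply: (QM) => //.
rewrite mpolyXE_id; elim/big_ind: _ => [||j _].
- by rewrite -(mpolyC1 N R).
- exact: QM.
- elim: (m j) => [|k IH]; first by rewrite expr0 -(mpolyC1 N R).
  by rewrite exprS; exact: QM.
Qed.

(* Main.v *)
Require Import Defs.
From mathcomp Require Import all_boot all_order all_algebra.
From mathcomp Require Import all_classical all_reals all_analysis.
From mathcomp Require Import -(notations) mpoly.
Import Order.TTheory GRing.Theory Num.Theory.
Import numFieldNormedType.Exports.
Local Open Scope classical_set_scope.
Local Open Scope ring_scope.

(** At a zero of [f + eps P] one has [|f| = eps |P|], and if the zero is singular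
    also [|grad f| = eps |grad P|].  Such an equality is impossible where its
    left-hand function is positive and at least the function that [eps < 1]
    multiplies on the right.  This rules out the first equality on [U \ B], so
    every zero in [U] lies in [B], and the second on [B], so none of these zeros
    is singular.  Both exclusions are the same comparison of an infimum with a
    supremum, [neq_scale_of_sup_le_inf]. *)

(** The infimum of [g] separates the two functions: on [S],
    [h x <= inf g <= g x] with [g x > 0], so [eps * h x < g x]. *)
Lemma neq_scale_of_sup_le_inf (R : realType) (N : nat) (S : set 'rV[R]_N)
    (g h : 'rV[R]_N -> R) (eps : R) (x : 'rV[R]_N) :
  (0 < inf_on S g)%E -> (sup_on S h <= inf_on S g)%E ->
  0 <= eps < 1 -> S x -> g x <> eps * h x.
Proof.
move=> inf_gt0 sup_le_inf /andP[eps_ge0 eps_lt1] Sx gE.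
have inf_le : (inf_on S g <= (g x)%:E)%E by apply: ereal_inf_lbound; exists x.
have le_sup : ((h x)%:E <= sup_on S h)%E by apply: ereal_sup_ubound; exists x.
have gx_gt0 : 0 < g x by rewrite -lte_fin (lt_le_trans inf_gt0).
have hx_le_gx : h x <= g x.
  by rewrite -lee_fin (le_trans le_sup)// (le_trans sup_le_inf).
have : eps * h x < g x.
  by rewrite (le_lt_trans (ler_wpM2l eps_ge0 hx_le_gx))// gtr_pMl.
by rewrite -gE ltxx.
Qed.

Lemma enormZ (R : realType) (N : nat) (a : R) (v : 'rV[R]_N) :
  enorm (a *: v) = `|a| * enorm v.
Proof.
rewrite /enorm -sqrtr_sqr -sqrtrM ?sqr_ge0// mulr_sumr.
by under eq_bigr do rewrite mxE exprMn.
Qed.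

Lemma pevalDZ (R : realType) (N : nat) (f P : mpoly N R) (eps : R)
    (x : 'rV[R]_N) :
  peval (f + eps *: P) x = peval f x + eps * peval P x.
Proof. by rewrite /peval mevalD mevalZ. Qed.

Lemma gradDZ (R : realType) (N : nat) (f P : mpoly N R) (eps : R)
    (x : 'rV[R]_N) :
  grad (f + eps *: P) x = grad f x + eps *: grad P x.
Proof. by apply/rowP => i; rewrite !mxE mderivD mderivZ pevalDZ. Qed.

Theorem proposition8p1 (R : realType) (N : nat) (B U : set 'rV[R]_N)
    (f P : mpoly N R) (delta xi : \bar R)
    (BU : B `<=` U)
    (delta_def : delta = inf_on B (fun x => enorm (grad f x)))
    (xi_def : xi = inf_on (U `\` B) (fun x => `|peval f x|))
    (delta_gt0 : (0 < delta)%E)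
    (xi_gt0 : (0 < xi)%E)
    (P_le_xi : (C0norm (U `\` B) P <= xi)%E)
    (gradP_le_delta : (C0norm_grad B P <= delta)%E) :
  forall eps : R, 0 <= eps < 1 -> Meps_smooth U f P eps.
Proof.
move=> eps eps01 x [zx Ux] gradx0; subst delta xi.
have eps_ge0 : 0 <= eps by case/andP: eps01.
have [Bx|nBx] := pselect (B x).
- apply: (neq_scale_of_sup_le_inf _ _ B _ _ _ _
    delta_gt0 gradP_le_delta eps01 Bx).
  move: gradx0; rewrite gradDZ => /eqP; rewrite addr_eq0 -scaleNr => /eqP ->.
  by rewrite enormZ normrN ger0_norm.
- apply: (neq_scale_of_sup_le_inf _ _ (U `\` B) _ _ _ _
    xi_gt0 P_le_xi eps01 (conj Ux nBx)).
  move: zx; rewrite /zero_locus /= pevalDZ => /eqP; rewrite addr_eq0 => /eqP ->.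
  by rewrite normrN normrM ger0_norm.
Qed.
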